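(* Let $\Omega\subset\mathbb R^n$ be a bounded domain, $p\in(1,\infty)$, $\gamma\in(-1,\infty)$, and let $\mathfrak a:\Omega\to\mathbb R$ be continuous with $0<\lambda_0\le\mathfrak a\le\Lambda_0<\infty$ in $\Omega$. Let $u$ be a non-negative, bounded viscosity solution of $$|\nabla u(x)|^\gamma\Delta_p^{\mathrm N}u(x)=\mathfrak a(x)\,u_+^{\gamma+1}(x)\quad\text{in }\Omega.$$ Then the following dichotomy holds: either $u>0$ in $\Omega$ or $u\equiv0$ in $\Omega$.
   Context: $B_r(x)$ is the open ball in $\mathbb R^n$ of radius $r$ centred at $x$; $u_+=\max\{u,0\}$. The normalized $p$-Laplacian is $\Delta_p^{\mathrm N}u=\Delta u+(p-2)\left\langle D^2u\,\frac{\nabla u}{|\nabla u|},\frac{\nabla u}{|\nabla u|}\right\rangle$. Viscosity solutions of $|\nabla u|^\gamma\Delta_p^{\mathrm N}u=f(x,u)$ in an open set $\Omega$ ($f$ continuous), for continuous $u$: Case $\gamma\ge0$. $u$ is a subsolution (resp. supersolution) if whenever $\phi\in C^2(\Omega)$ and $u-\phi$ has a local maximum (resp. minimum) at $x_0\in\Omega$ with $\phi(x_0)=u(x_0)$: (1) if $\nabla\phi(x_0)\ne0$, then $|\nabla\phi(x_0)|^\gamma\Delta_p^{\mathrm N}\phi(x_0)\ge f(x_0,\phi(x_0))$ (resp. $\le$); (2) if $\nabla\phi(x_0)=0$, then for $p\ge2$: $\Delta\phi(x_0)+(p-2)\lambda_{\max}(D^2\phi(x_0))\ge f(x_0,\phi(x_0))$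 (resp. $\Delta\phi(x_0)+(p-2)\lambda_{\min}(D^2\phi(x_0))\le f(x_0,\phi(x_0))$), and for $1<p<2$ the same with $\lambda_{\max}$ and $\lambda_{\min}$ interchanged. Here $\lambda_{\max},\lambda_{\min}$ denote the largest and smallest eigenvalues. Case $-1<\gamma<0$. $u$ is a subsolution (resp. supersolution) if for all $\varphi\in C^2(\Omega)$ such that $u-\varphi$ has a local maximum (resp. minimum) at $x_0$, $\varphi(x_0)=u(x_0)$, and $\nabla\varphi(x)\ne0$ for $x\ne x_0$, one has $\lim_{r\to0}\inf_{x\in B_r(x_0),x\ne x_0}\left(-|\nabla\varphi(x)|^\gamma\Delta_p^{\mathrm N}\varphi(x)\right)\le -f(x_0,\varphi(x_0))$ (resp. $\lim_{r\to0}\sup_{x\in B_r(x_0),x\ne x_0}\left(-|\nabla\varphi(x)|^\gamma\Delta_p^{\mathrm N}\varphi(x)\right)\ge -f(x_0,\varphi(x_0))$). A solution is both a subsolution and a supersolution. *)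

(* Defs.v *)
From HB Require Import structures.
From mathcomp Require Import all_boot all_order all_algebra.
From mathcomp Require Import all_classical all_reals all_analysis.

Set Implicit Arguments.
Unset Strict Implicit.
Unset Printing Implicit Defensive.

Import Order.TTheory GRing.Theory Num.Theory.
Import numFieldNormedType.Exports.

Local Open Scope classical_set_scope.
Local Open Scope ring_scope.

Section Calculus.
Context {R : realType} {n : nat}.
Implicit Types (x v : 'rV[R]_n) (phi : 'rV[R]_n -> R) (Omega : set 'rV[R]_n).

(* The library norm of 'rV[R]_n is the sup norm; it induces the usual topology
   and bounded sets, but the length of the gradient and the balls B_r(x) are
   Euclidean. *)
Definition enorm v : R := Num.sqrt (\sum_(i < n) v 0 i ^+ 2).

Definition eball x (r : R) : set 'rV[R]_n := [set y | enorm (y - x) < r].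

Definition domain Omega : Prop := [/\ Omega !=set0, open Omega & connected Omega].

Definition partial (i : 'I_n) phi : 'rV[R]_n -> R :=
  fun x => 'D_(delta_mx 0 i) phi x.

Definition gradient phi x : 'rV[R]_n := \row_i partial i phi x.

Definition hessian phi x : 'M[R]_n := \matrix_(i, j) partial j (partial i phi) x.

(* Functions on an open set Omega are represented by total functions of which
   only the values on Omega matter. *)
Definition C1_on Omega phi : Prop :=
  {within Omega, continuous phi} /\
  forall i : 'I_n,
    (forall x, Omega x -> derivable phi x (delta_mx 0 i)) /\
    {within Omega, continuous (partial i phi)}.

Definition C2_on Omega phi : Prop :=
  C1_on Omega phi /\ forall i : 'I_n, C1_on Omega (partial i phi).

(* Used for real symmetric matrices of positive size only: the set of
   eigenvalues is then finite and nonempty, so that sup and inf are attained. *)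
Definition lambda_max (A : 'M[R]_n) : R := sup [set a : R | eigenvalue A a].
Definition lambda_min (A : 'M[R]_n) : R := inf [set a : R | eigenvalue A a].

Definition laplacian phi x : R := \tr (hessian phi x).

(* Meaningful only where the gradient does not vanish. *)
Definition normalized_pLaplacian (p : R) phi x : R :=
  let nu := (enorm (gradient phi x))^-1 *: gradient phi x in
  laplacian phi x + (p - 2) * (nu *m hessian phi x *m nu^T) 0 0.

Definition pde_operator (gamma p : R) phi x : R :=
  enorm (gradient phi x) `^ gamma * normalized_pLaplacian p phi x.

End Calculus.

Section Viscosity.
Context {R : realType} {n : nat}.
Variables (gamma p : R) (f : 'rV[R]_n -> R -> R) (Omega : set 'rV[R]_n).
Implicit Types (x : 'rV[R]_n) (u phi : 'rV[R]_n -> R).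

Definition touches_from_above u phi x0 : Prop :=
  phi x0 = u x0 /\ \forall x \near x0, u x - phi x <= u x0 - phi x0.

Definition touches_from_below u phi x0 : Prop :=
  phi x0 = u x0 /\ \forall x \near x0, u x0 - phi x0 <= u x - phi x.

Definition subsolution_nonneg u : Prop :=
  forall phi x0, C2_on Omega phi -> Omega x0 -> touches_from_above u phi x0 ->
    (gradient phi x0 != 0 -> f x0 (phi x0) <= pde_operator gamma p phi x0) /\
    (gradient phi x0 = 0 ->
      f x0 (phi x0) <= laplacian phi x0 + (p - 2) *
        (if 2 <= p then lambda_max (hessian phi x0)
         else lambda_min (hessian phi x0))).

Definition supersolution_nonneg u : Prop :=
  forall phi x0, C2_on Omega phi -> Omega x0 -> touches_from_below u phi x0 ->
    (gradient phi x0 != 0 -> pde_operator gamma p phi x0 <= f x0 (phi x0)) /\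
    (gradient phi x0 = 0 ->
      laplacian phi x0 + (p - 2) *
        (if 2 <= p then lambda_min (hessian phi x0)
         else lambda_max (hessian phi x0)) <= f x0 (phi x0)).

(* For gamma < 0 the operator may be unbounded near x0, so the infimum and the
   supremum are taken in the extended reals. Being monotone in r, they have
   limits as r tends to 0 from the right. *)
Definition subsolution_neg u : Prop :=
  forall phi x0, C2_on Omega phi -> Omega x0 -> touches_from_above u phi x0 ->
    (forall x, Omega x -> x != x0 -> gradient phi x != 0) ->
    (lim (ereal_inf [set (- pde_operator gamma p phi x)%:E
                    | x in eball x0 r `\ x0] @[r --> 0^'+])
      <= (- f x0 (phi x0))%:E)%E.

Definition supersolution_neg u : Prop :=
  forall phi x0, C2_on Omega phi -> Omega x0 -> touches_from_below u phi x0 ->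
    (forall x, Omega x -> x != x0 -> gradient phi x != 0) ->
    ((- f x0 (phi x0))%:E <=
      lim (ereal_sup [set (- pde_operator gamma p phi x)%:E
                     | x in eball x0 r `\ x0] @[r --> 0^'+]))%E.

Definition viscosity_subsolution u : Prop :=
  if 0 <= gamma then subsolution_nonneg u else subsolution_neg u.

Definition viscosity_supersolution u : Prop :=
  if 0 <= gamma then supersolution_nonneg u else supersolution_neg u.

Definition viscosity_solution u : Prop :=
  [/\ {within Omega, continuous u},
      viscosity_subsolution u & viscosity_supersolution u].

End Viscosity.

(* Main.v *)
(** Let z be a zero of u on the boundary of a ball B(y, r) on which u > 0. In
    place of Hopf's radial barrier, whose gradient vanishes at y, take
    phi = c (exp (al psi) - 1) with psi(x) = t - (|x - z|^2 - t^2) / r, where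
    t = <nu, x - z> and nu = (y - z) / r. The set psi > 0 is the inside of a
    paraboloid that near z lies in B(y, r), and <nu, grad psi> = 1, so grad phi
    never vanishes: a single test function serves all gamma > -1, including the
    singular range, where test functions must not have a second critical point.
    For al large, |grad phi|^gamma Delta_p^N phi >= K (c exp (al psi))^(gamma+1)
    with K > Lambda0. For c small, u - phi is positive on the boundary of a small
    ball around z and zero at z, so its minimum m <= 0 is attained inside, and
    phi + m touches u from below there; there 0 <= phi + m <= c exp (al psi), so
    the equation is violated. Such a ball exists because otherwise the zero set
    would be open and closed in Omega. *)

Require Import Defs.
From HB Require Import structures.
From mathcomp Require Import all_boot all_order all_algebra.
From mathcomp Require Import all_classical all_reals all_analysis.
From mathcomp Require Import ring lra.

Set Implicit Arguments.
Unset Strict Implicit.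
Unset Printing Implicit Defensive.

Import Order.TTheory GRing.Theory Num.Theory.
Import numFieldNormedType.Exports.

Local Open Scope classical_set_scope.
Local Open Scope ring_scope.

(** * Continuity of pointwise sums, differences and products *)

Section PointwiseContinuity.
Context {T : topologicalType} {R : realType}.
Implicit Types f g : T -> R.

Lemma continuous_fun_cst (a : R) : continuous (fun _ : T => a).
Proof. by move=> x; exact: cvg_cst. Qed.

Lemma continuous_funD f g :
  continuous f -> continuous g -> continuous (fun x => f x + g x).
Proof. by move=> fc gc x; exact: cvgD (fc x) (gc x). Qed.

Lemma continuous_funB f g :
  continuous f -> continuous g -> continuous (fun x => f x - g x).
Proof. by move=> fc gc x; exact: cvgB (fc x) (gc x). Qed.

Lemma continuous_funM f g :
  continuous f -> continuous g -> continuous (fun x => f x * g x).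
Proof. by move=> fc gc x; exact: cvgM (fc x) (gc x). Qed.

Lemma continuous_fun_sum (I : Type) (r : seq I) (F : I -> T -> R) :
  (forall i, continuous (F i)) -> continuous (fun x => \sum_(i <- r) F i x).
Proof.
move=> Fc; elim: r => [|i r IH].
  by under eq_fun do rewrite big_nil; exact: continuous_fun_cst.
by under eq_fun do rewrite big_cons; exact: continuous_funD.
Qed.

End PointwiseContinuity.

(** * The Euclidean inner product on row vectors *)

Section Dot.
Context {R : realType} {n : nat}.
Implicit Types u v w : 'rV[R]_n.

Definition dot u v : R := \sum_i u 0 i * v 0 i.

Lemma dotC u v : dot u v = dot v u.
Proof. by apply: eq_bigr => i _; rewrite mulrC. Qed.

Lemma dotDl u v w : dot (u + v) w = dot u w + dot v w.
Proof. by rewrite -big_split/=; apply: eq_bigr => i _; rewrite mxE mulrDl. Qed.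

Lemma dotZl a u v : dot (a *: u) v = a * dot u v.
Proof. by rewrite mulr_sumr; apply: eq_bigr => i _; rewrite mxE mulrA. Qed.

Lemma dotNl u v : dot (- u) v = - dot u v.
Proof. by rewrite -scaleN1r dotZl mulN1r. Qed.

Lemma dotDr u v w : dot w (u + v) = dot w u + dot w v.
Proof. by rewrite dotC dotDl !(dotC w). Qed.

Lemma dotZr a u v : dot u (a *: v) = a * dot u v.
Proof. by rewrite dotC dotZl dotC. Qed.

Lemma dotNr u v : dot u (- v) = - dot u v.
Proof. by rewrite dotC dotNl dotC. Qed.

Definition dotE := (dotDl, dotDr, dotNl, dotNr, dotZl, dotZr).

Lemma dot_delta u i : dot u (delta_mx 0 i) = u 0 i.
Proof.
rewrite /dot (bigD1 i)//= mxE !eqxx mulr1 big1 ?addr0// => j ji.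
by rewrite mxE eqxx (negbTE ji) mulr0.
Qed.

Lemma dot_ge0 u : 0 <= dot u u.
Proof. by apply: sumr_ge0 => i _; rewrite -expr2 sqr_ge0. Qed.

Lemma dot_gt0 u : u != 0 -> 0 < dot u u.
Proof.
apply: contraNT; rewrite -leNgt => u0.
have /psumr_eq0P uu0 : \sum_i u 0 i * u 0 i = 0.
  by apply/eqP; rewrite eq_le u0 dot_ge0.
apply/eqP/rowP => i; rewrite mxE; apply/eqP.
by rewrite -sqrf_eq0 expr2 uu0// => j _; rewrite -expr2 sqr_ge0.
Qed.

Lemma enormE u : enorm u = Num.sqrt (dot u u).
Proof. by congr Num.sqrt; apply: eq_bigr => i _; rewrite expr2. Qed.

Lemma sqr_enorm u : enorm u ^+ 2 = dot u u.
Proof. by rewrite enormE sqr_sqrtr// dot_ge0. Qed.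

Lemma enormZ a u : enorm (a *: u) = `|a| * enorm u.
Proof.
by rewrite !enormE dotZl dotZr mulrA -expr2 sqrtrM ?sqr_ge0// sqrtr_sqr.
Qed.

Lemma mul_row_trmx u v : (u *m v^T) 0 0 = dot u v.
Proof. by rewrite mxE; apply: eq_bigr => i _; rewrite mxE. Qed.

(** Cauchy-Schwarz for a unit vector: the part of [v] orthogonal to [u] has non-negative squared
    length. *)
Lemma dot_sqr_le u v : dot u u = 1 -> dot u v ^+ 2 <= dot v v.
Proof.
move=> u1; have := dot_ge0 (v - dot u v *: u).
rewrite !dotE u1 (dotC v u); lra.
Qed.

Lemma continuous_dot (T : topologicalType) (f g : T -> 'rV[R]_n) :
  continuous f -> continuous g -> continuous (fun x => dot (f x) (g x)).
Proof.
move=> fc gc; apply: continuous_fun_sum => i.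
apply: continuous_funM => x.
- exact: continuous_comp (fc x) (@coord_continuous _ _ _ _ _ _).
- exact: continuous_comp (gc x) (@coord_continuous _ _ _ _ _ _).
Qed.

Lemma continuous_dot_sub (u z : 'rV[R]_n) : continuous (fun x : 'rV[R]_n => dot u (x - z)).
Proof.
under eq_fun do rewrite !dotE.
apply: continuous_funB; last exact: continuous_fun_cst.
by apply: continuous_dot => x; [exact: cst_continuous|exact: cvg_id].
Qed.

Lemma continuous_sqdist (z : 'rV[R]_n) :
  continuous (fun x : 'rV[R]_n => dot (x - z) (x - z)).
Proof.
have -> : (fun x : 'rV[R]_n => dot (x - z) (x - z)) =
    (fun x => dot x x - 2 * dot z (x - z) - dot z z).
  by apply/funext => x; rewrite !dotE (dotC x z); ring.
apply: continuous_funB; last exact: continuous_fun_cst.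
apply: continuous_funB; first by apply: continuous_dot => x; exact: cvg_id.
by apply: continuous_funM; [exact: continuous_fun_cst|exact: continuous_dot_sub].
Qed.

(** Both derivatives are limits of the same difference quotient, so directional derivatives reduce
    to calculus in one variable. *)
Lemma is_derive_line (f : 'rV[R]_n -> R) (x v : 'rV[R]_n) (df : R) :
  is_derive (0 : R) 1 (fun h : R => f (h *: v + x)) df -> is_derive x v f df.
Proof.
case=> fd <-; split; first exact/derivable1P.
rewrite /derive; set g1 := fun h => h^-1 *: _; set g2 := fun h => h^-1 *: _.
suff -> : g1 = g2 by [].
by apply/funext => h; rewrite /g1 /g2/= addr0 scale0r add0r [_%:A]mulr1.
Qed.

End Dot.

(** * The exponential paraboloid barrier: its derivatives and a lower bound for the operator *)

Section Barrier.
Context {R : realType} {n : nat}.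
Variables (z nu : 'rV[R]_n) (k al c m : R).
Implicit Types x v w : 'rV[R]_n.

(** For a unit vector [nu], the factor of [k] is the squared distance from [x] to the line through
    [z] in direction [nu]. *)
Definition paraboloid x : R :=
  dot nu (x - z) - k * (dot (x - z) (x - z) - dot nu (x - z) ^+ 2).

Definition paraboloid_grad x : 'rV[R]_n :=
  nu - (2 * k) *: ((x - z) - dot nu (x - z) *: nu).

(** The constant [m] stays free: [- c] makes the barrier vanish at [z], other values give its
    vertical translates, among them the one that touches [u]. *)
Definition barrier x : R := c * expR (al * paraboloid x) + m.

Local Notation psi := paraboloid.
Local Notation q := paraboloid_grad.
Local Notation phi := barrier.
Local Notation A x := (c * al * expR (al * psi x)).

(** A quadratic polynomial is its own second-order expansion along a line, so no remainder
    appears. *)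
Lemma paraboloid_line x v h : psi (h *: v + x) =
  psi x + dot (q x) v * h - (k * (dot v v - dot nu v ^+ 2)) * h ^+ 2.
Proof.
rewrite /psi /q -(addrA (h *: v)); move: (x - z) => y.
by rewrite !dotE (dotC v y); ring.
Qed.

Lemma paraboloid_grad_line x v h : q (h *: v + x) =
  q x - (2 * k * h) *: (v - dot nu v *: nu).
Proof.
rewrite /q -(addrA (h *: v)); move: (x - z) => y.
apply/rowP => i; rewrite !mxE !dotE; ring.
Qed.

(** One formula serves twice: a constant second factor ([t] = 0) gives the gradient of the barrier,
    an affine one gives its Hessian. *)
Lemma is_derive_exp_quad (a b d s t : R) :
  is_derive (0 : R) 1 (fun h : R => expR (al * (a + b * h - d * h ^+ 2)) *
     (s + t * h)) (expR (al * a) * (al * b * s + t)).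
Proof.
have id0 := is_derive_id (0 : R) 1.
have lin (e : R) : is_derive (0 : R) 1 (fun h : R => e * h) e.
  by apply: (is_derive_eq (is_deriveZ e id0)); exact: mulr1.
have ed : is_derive (0 : R) 1
    (fun h : R => expR (al * (a + b * h - d * h ^+ 2))) (expR (al * a) * (al * b)).
  apply: (@is_derive1_comp _ expR (fun h => al * (a + b * h - d * h ^+ 2))).
    by rewrite mulr0 addr0 expr0n/= mulr0 subr0; exact: is_derive_expR.
  apply: (is_derive_eq (is_deriveZ al (is_deriveB (is_deriveD
    (is_derive_cst a (0 : R) 1) (lin b)) (is_deriveZ d (is_deriveX 2 id0))))).
  by rewrite /GRing.scale/=; ring.
apply: (is_derive_eq (is_deriveM ed
  (is_deriveD (is_derive_cst s (0 : R) 1) (lin t)))).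
rewrite /GRing.scale/= addrfctE/= !mulr0 !addr0 expr0n/= mulr0 subr0; ring.
Qed.

Lemma is_derive_barrier x v : is_derive x v phi (A x * dot (q x) v).
Proof.
apply: is_derive_line; rewrite /phi.
under [X in is_derive _ _ X]eq_fun do rewrite paraboloid_line.
have := is_derive_exp_quad (psi x) (dot (q x) v)
  (k * (dot v v - dot nu v ^+ 2)) c 0.
move=> /is_deriveD /(_ (is_derive_cst m (0 : R) 1)).
set f := (X in is_derive _ _ X _ -> _); set g := (X in _ -> is_derive _ _ X _).
have -> : g = f by apply/funext => h; rewrite /f /g !fctE; ring.
by move/is_derive_eq; apply; ring.
Qed.

Lemma partial_barrier i : partial i phi = fun x => A x * q x 0 i.
Proof.
by apply/funext => x; have [_] := is_derive_barrier x (delta_mx 0 i);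
  rewrite dot_delta.
Qed.

Lemma is_derive_partial_barrier i x v : is_derive x v (partial i phi)
  (A x * (al * dot (q x) v * q x 0 i - 2 * k * (v 0 i - dot nu v * nu 0 i))).
Proof.
rewrite partial_barrier; apply: is_derive_line.
under [X in is_derive _ _ X]eq_fun do rewrite paraboloid_line paraboloid_grad_line.
have := is_derive_exp_quad (psi x) (dot (q x) v)
  (k * (dot v v - dot nu v ^+ 2)) (c * al * q x 0 i)
  (- (c * al * (2 * k * (v 0 i - dot nu v * nu 0 i)))).
set f := (X in is_derive _ _ X _ -> _); set g := (X in _ -> is_derive _ _ X _).
have -> : g = f by apply/funext => h; rewrite /f /g !mxE; ring.
by move/is_derive_eq; apply; ring.
Qed.

Lemma gradient_barrier x : gradient phi x = A x *: q x.
Proof. by apply/rowP => i; rewrite mxE partial_barrier [RHS]mxE. Qed.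

(** The exponential contributes a rank-one term along the gradient, amplified by [al]; the
    paraboloid contributes a constant matrix, for unit [nu] a multiple of the projection orthogonal
    to [nu]. *)
Lemma hessian_barrier x : hessian phi x = A x *:
  (al *: ((q x)^T *m q x) - (2 * k) *: (1%:M - nu^T *m nu)).
Proof.
apply/matrixP => i j; rewrite mxE.
have [_] := is_derive_partial_barrier i x (delta_mx 0 j).
rewrite /partial => ->; rewrite !dot_delta !mxE eqxx/= !big_ord1 !mxE.
by rewrite (eq_sym i j); ring.
Qed.

Lemma continuous_paraboloid : continuous psi.
Proof.
apply: continuous_funB; first exact: continuous_dot_sub.
apply: continuous_funM; first exact: continuous_fun_cst.
apply: continuous_funB; first exact: continuous_sqdist.
by apply: continuous_funM; exact: continuous_dot_sub.
Qed.

Lemma continuous_expR_paraboloid a : continuous (fun x => a * expR (al * psi x)).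
Proof.
apply: continuous_funM => [|x]; first exact: continuous_fun_cst.
apply: continuous_comp; last exact: continuous_expR.
apply: (continuous_funM (@continuous_fun_cst _ _ al)).
exact: continuous_paraboloid.
Qed.

Lemma continuous_paraboloid_grad i : continuous (fun x => q x 0 i).
Proof.
have -> : (fun x => q x 0 i) = fun x =>
    nu 0 i - 2 * k * (x 0 i - z 0 i - dot nu (x - z) * nu 0 i).
  by apply/funext => x; rewrite !mxE.
apply: continuous_funB; first exact: continuous_fun_cst.
apply: continuous_funM; first exact: continuous_fun_cst.
apply: continuous_funB.
  apply: continuous_funB; last exact: continuous_fun_cst.
  exact: coord_continuous.
by apply: continuous_funM; [exact: continuous_dot_sub|exact: continuous_fun_cst].
Qed.

Lemma continuous_barrier : continuous phi.
Proof.
apply: continuous_funD; first exact: continuous_expR_paraboloid.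
exact: continuous_fun_cst.
Qed.

Lemma C2_barrier Omega : C2_on Omega phi.
Proof.
have pc i : continuous (partial i phi).
  rewrite partial_barrier; apply: continuous_funM.
    exact: continuous_expR_paraboloid.
  exact: continuous_paraboloid_grad.
split=> [|i]; split=> [|j].
- exact/continuous_subspaceT/continuous_barrier.
- split; last exact/continuous_subspaceT/pc.
  by move=> x _; case: (is_derive_barrier x (delta_mx 0 j)).
- exact/continuous_subspaceT/pc.
- split=> [x _|].
    by case: (is_derive_partial_barrier i x (delta_mx 0 j)).
  apply: continuous_subspaceT.
  have -> : partial j (partial i phi) = fun x => A x *
      (al * q x 0 j * q x 0 i - 2 * k * ((j == i)%:R - nu 0 j * nu 0 i)).
    apply/funext => x; have [_] := is_derive_partial_barrier i x (delta_mx 0 j).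
    by rewrite /partial => ->; rewrite !dot_delta [delta_mx _ _ _ _]mxE eqxx (eq_sym i j).
  apply: continuous_funM; first exact: continuous_expR_paraboloid.
  apply: continuous_funB; last exact: continuous_fun_cst.
  apply: continuous_funM; last exact: continuous_paraboloid_grad.
  apply: continuous_funM; last exact: continuous_paraboloid_grad.
  exact: continuous_fun_cst.
Qed.

Lemma laplacian_barrier x : dot nu nu = 1 ->
  laplacian phi x = A x * (al * dot (q x) (q x) - 2 * k * (n%:R - 1)).
Proof.
have trB (M P : 'M[R]_n) : \tr (M - P) = \tr M - \tr P by exact: raddfB.
move=> nu1; rewrite /laplacian hessian_barrier mxtraceZ trB !mxtraceZ trB.
rewrite mxtrace1 !(mxtrace_mulC _^T) /mxtrace !big_ord1.
by rewrite !mul_row_trmx nu1.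
Qed.

Lemma hessian_form_barrier x w : (w *m hessian phi x *m w^T) 0 0 =
  A x * (al * dot (q x) w ^+ 2 - 2 * k * (dot w w - dot nu w ^+ 2)).
Proof.
have outer v : (w *m (v^T *m v) *m w^T) 0 0 = dot v w ^+ 2.
  rewrite mulmxA -(mulmxA _ v) mxE big_ord1 !mul_row_trmx (dotC w).
  by rewrite expr2.
have formZ a M : (w *m (a *: M) *m w^T) 0 0 = a * (w *m M *m w^T) 0 0.
  by rewrite -scalemxAr -scalemxAl mxE.
have formB M N : (w *m (M - N) *m w^T) 0 0 =
    (w *m M *m w^T) 0 0 - (w *m N *m w^T) 0 0.
  by rewrite mulmxBr mulmxBl [LHS]mxE; congr (_ + _); rewrite mxE.
rewrite hessian_barrier formZ formB !formZ formB !outer mulmx1.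
by rewrite mul_row_trmx.
Qed.

(** The correction to [nu] in the gradient is orthogonal to [nu]. Hence the gradient cannot vanish
    and has length at least 1. *)
Lemma dot_paraboloid_grad x : dot nu nu = 1 -> dot nu (q x) = 1.
Proof. by move=> nu1; rewrite /q !dotE nu1; ring. Qed.

Lemma paraboloid_grad_neq0 x : dot nu nu = 1 -> q x != 0.
Proof.
move=> nu1; apply/eqP => q0; have := dot_paraboloid_grad x nu1.
rewrite q0 -(scale0r nu) dotZr mul0r => /eqP.
by rewrite eq_sym oner_eq0.
Qed.

Lemma gradient_barrier_neq0 x :
  dot nu nu = 1 -> 0 < c -> 0 < al -> gradient phi x != 0.
Proof.
move=> nu1 c0 al0; rewrite gradient_barrier scaler_eq0 negb_or.
by rewrite paraboloid_grad_neq0// !mulf_neq0// gt_eqF// expR_gt0.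
Qed.

(** The rank-one term of the Hessian gains (p - 1) al N^2, with N the length of [q x]; the curvature
    of the paraboloid costs a bounded amount. Both sides scale with exponent [gamma + 1]. *)
Lemma pde_operator_barrier_ge (gamma p : R) x :
  dot nu nu = 1 -> 0 <= k -> 0 < c -> 1 <= al -> -1 < gamma -> 1 < p ->
  0 <= (p - 1) * al - 2 * k * (n%:R + `|p - 2|) ->
  ((p - 1) * al - 2 * k * (n%:R + `|p - 2|)) *
    (c * expR (al * psi x)) `^ (gamma + 1) <= pde_operator gamma p phi x.
Proof.
move=> nu1 k0 c0 al1 g1 p1; set K := (X in 0 <= X) => K0.
set E := c * expR _.
have E0 : 0 < E by rewrite mulr_gt0// expR_gt0.
have al0 : 0 < al by lra.
have A0 : 0 < A x by rewrite !mulr_gt0// expR_gt0.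
have AE : A x = al * E by rewrite /E; ring.
set N := enorm (q x).
have N2 : N ^+ 2 = dot (q x) (q x) by rewrite sqr_enorm.
have N1 : 1 <= N.
  rewrite -(@ler_pXn2r _ 2) ?nnegrE ?sqrtr_ge0 ?ler01// expr1n N2.
  by rewrite (le_trans _ (dot_sqr_le (q x) nu1))// dot_paraboloid_grad// expr1n.
have N0 : 0 < N by lra.
rewrite /pde_operator gradient_barrier enormZ (gtr0_norm A0) -/N.
rewrite /normalized_pLaplacian gradient_barrier enormZ (gtr0_norm A0) -/N.
have -> : (A x * N)^-1 *: (A x *: q x) = N^-1 *: q x.
  by rewrite scalerA invfM mulrAC mulVf ?mul1r// gt_eqF.
rewrite laplacian_barrier// hessian_form_barrier -N2.
set w := N^-1 *: q x.
have -> : dot (q x) w = N.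
  by rewrite dotZr -N2 expr2 mulrA mulVf ?mul1r// gt_eqF.
have w1 : dot w w = 1.
  by rewrite dotZl dotZr -N2 mulrA -expr2 -exprMn mulVf ?expr1n// gt_eqF.
have := dot_sqr_le w nu1; rewrite w1.
have := sqr_ge0 (dot nu w); set s := dot nu w ^+ 2 => s0 s1.
(* As [s] lies between 0 and 1, the terms carrying [k] cost at most 2k(n + |p - 2|), and since N^2
   >= 1 this is at most the same constant times N^2. *)
have bound : K * N ^+ 2 <= al * N ^+ 2 - 2 * k * (n%:R - 1) +
   (p - 2) * (al * N ^+ 2 - 2 * k * (1 - s)).
  have absle : - `|p - 2| <= p - 2 <= `|p - 2| by rewrite -ler_norml.
  have -> : K * N ^+ 2 = (p - 1) * al * N ^+ 2 -
      2 * k * (n%:R + `|p - 2|) * N ^+ 2 by rewrite /K; ring.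
  have N21 : 1 <= N ^+ 2 by rewrite exprn_ege1.
  have C0 : 0 <= 2 * k * (n%:R + `|p - 2|) by rewrite !mulr_ge0// addr_ge0.
  have CN : 2 * k * (n%:R + `|p - 2|) <=
      2 * k * (n%:R + `|p - 2|) * N ^+ 2 by rewrite ler_peMr.
  have ps : (p - 2) * (1 - s) <= `|p - 2|.
    rewrite (le_trans (ler_norm _))// normrM ler_piMr//.
    by rewrite ger0_norm; lra.
  have := ler_wpM2l (mulr_ge0 (ler0n _ 2) k0) ps; nra.
have -> : A x * (al * N ^+ 2 - 2 * k * (n%:R - 1)) +
   (p - 2) * (A x * (al * N ^+ 2 - 2 * k * (1 - s))) =
   A x * (al * N ^+ 2 - 2 * k * (n%:R - 1) +
     (p - 2) * (al * N ^+ 2 - 2 * k * (1 - s))) by ring.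
apply: (@le_trans _ _ ((A x * N) `^ gamma * (A x * (K * N ^+ 2)))); last first.
  by rewrite ler_wpM2l ?powR_ge0// ler_wpM2l// ltW.
(* Joining [A x] and one factor [N] to the power raises the exponent to [gamma + 1], which is
   positive, so [E <= A x * N] can be used even for negative [gamma]. The spare factor [N] is at
   least 1. *)
have -> : (A x * N) `^ gamma * (A x * (K * N ^+ 2)) =
    K * (A x * N) `^ (gamma + 1) * N.
  rewrite powRD; last by apply/implyP => _; rewrite mulf_neq0 ?gt_eqF.
  rewrite (powRr1 (ltW (mulr_gt0 A0 N0))); ring.
have EA : E <= A x * N.
  by rewrite AE (le_trans (ler_peMl (ltW E0) al1))// ler_peMr// mulr_ge0// ltW.
have EAg : E `^ (gamma + 1) <= (A x * N) `^ (gamma + 1).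
  by rewrite ge0_ler_powR ?nnegrE ?(ltW E0) ?(ltW (mulr_gt0 A0 N0))//; lra.
apply: le_trans (ler_wpM2l K0 EAg) _.
by rewrite ler_peMr// mulr_ge0// powR_ge0.
Qed.
End Barrier.

(** * Euclidean balls, and the barrier as a test function for the equation *)

Section EuclideanBall.
Context {R : realType} {n : nat}.
Implicit Types x y : 'rV[R]_n.

Lemma coord_le_enorm (v : 'rV[R]_n) i : `|v 0 i| <= enorm v.
Proof.
rewrite -sqrtr_sqr ler_wsqrtr// (bigD1 i)//= lerDl.
by apply: sumr_ge0 => j _; exact: sqr_ge0.
Qed.

Lemma eball_sub_ball x (r e : R) : 0 < e -> r <= e -> eball x r `<=` ball x e.
Proof.
move=> e0 re y /= xyr; split=> // i j; rewrite /ball/= (ord1 i) distrC.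
have := coord_le_enorm (y - x) j; rewrite !mxE => h.
exact: le_lt_trans h (lt_le_trans xyr re).
Qed.

(** The supremum is nondecreasing in [r], so the limit exists; for small [r] the Euclidean ball lies
    in the sup-norm ball where the bound holds. *)
Lemma lim_ereal_sup_eball_le (g : 'rV[R]_n -> R) x (L : R) :
  (\forall y \near x, g y <= L) ->
  (lim (ereal_sup [set (g y)%:E | y in eball x r `\ x] @[r --> 0^'+]) <= L%:E)%E.
Proof.
move=> /nbhs_ballP[e /= e0 gL]; apply: lime_le.
  apply: nondecreasing_at_right_is_cvge; near=> d => r s _ _ rs.
  apply: ereal_sup_le => _ [y [/= yr yx] <-]; exists y => //.
  by split=> //=; exact: lt_le_trans rs.
near=> r; apply: ge_ereal_sup => _ [y [yr _] <-]; rewrite lee_fin.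
apply: gL; apply: (eball_sub_ball e0 _ yr).
by near: r; exact: nbhs_right_le.
Unshelve. all: by end_near. Qed.

End EuclideanBall.

(** Put E = c exp(al psi). As [m <= 0], the positive part of the barrier is at most E, so the
    right-hand side is at most Lambda0 E^(gamma+1), strictly below the lower bound for the
    operator. *)
Lemma barrier_not_touching_from_below (R : realType) (n : nat)
    (Omega : set 'rV[R]_n) (p gamma Lambda0 : R) (a u : 'rV[R]_n -> R)
    (z nu : 'rV[R]_n) (k al c m : R) (x0 : 'rV[R]_n) :
  1 < p -> -1 < gamma -> 0 <= Lambda0 ->
  (forall x, Omega x -> 0 <= a x <= Lambda0) ->
  (forall x, Omega x -> 0 <= u x) ->
  viscosity_supersolution gamma p
    (fun x t => a x * Num.max t 0 `^ (gamma + 1)) Omega u ->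
  dot nu nu = 1 -> 0 <= k -> 0 < c -> m <= 0 -> 1 <= al ->
  Lambda0 < (p - 1) * al - 2 * k * (n%:R + `|p - 2|) ->
  Omega x0 -> ~ touches_from_below u (barrier z nu k al c m) x0.
Proof.
move=> p1 g1 L0 aL u0 usol nu1 k0 c0 m0 al1 LK Ox0 tch.
set phi := barrier _ _ _ _ _ _ in tch *.
set K := (X in _ < X) in LK.
pose E x := c * expR (al * paraboloid z nu k x).
have Epos x : 0 < E x by rewrite mulr_gt0// expR_gt0.
have g10 : 0 < gamma + 1 by lra.
have opge x : K * E x `^ (gamma + 1) <= pde_operator gamma p phi x.
  by apply: pde_operator_barrier_ge => //; rewrite -/K; lra.
have flt : a x0 * Num.max (phi x0) 0 `^ (gamma + 1) < K * E x0 `^ (gamma + 1).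
  apply: (@le_lt_trans _ _ (Lambda0 * E x0 `^ (gamma + 1))); last first.
    by rewrite ltr_pM2r// powR_gt0.
  have /andP[a0 aLx] := aL _ Ox0.
  have max0 : 0 <= Num.max (phi x0) 0 by rewrite le_max lexx orbT.
  have maxE : Num.max (phi x0) 0 <= E x0.
    by rewrite ge_max (ltW (Epos _)) andbT /phi /barrier -/(E x0); lra.
  by rewrite ler_pM ?powR_ge0// ge0_ler_powR ?nnegrE ?(ltW (Epos _)) ?(ltW g10).
have al0 : 0 < al by lra.
have grad0 x : gradient phi x != 0 by exact: gradient_barrier_neq0.
have C2phi : C2_on Omega phi by exact: C2_barrier.
move: usol; rewrite /viscosity_supersolution.
case: ifPn => [_ /(_ _ _ C2phi Ox0 tch) [/(_ (grad0 x0)) + _]|_].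
  by move=> /(le_trans (opge x0)) /le_lt_trans /(_ flt); rewrite ltxx.
move=> /(_ _ _ C2phi Ox0 tch (fun x _ _ => grad0 x)).
(* For negative [gamma] the inequality at [x0] is only a limit from nearby points. [L] is the
   midpoint of the strict gap, so by continuity the operator stays above [L], hence away from [f0],
   near [x0]. *)
set f0 := a x0 * _ in flt *; pose L := (f0 + K * E x0 `^ (gamma + 1)) / 2.
(* A power of an exponential is again an exponential of the paraboloid, whose continuity is
   known. *)
have EE x : K * E x `^ (gamma + 1) = K * c `^ (gamma + 1) *
    expR ((gamma + 1) * al * paraboloid z nu k x).
  rewrite powRM ?ltW ?expR_gt0// {2}/powR gt_eqF ?expR_gt0// expRK.
  by rewrite !mulrA.
have Enear : \forall x \near x0, L < K * E x `^ (gamma + 1).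
  have Ec := @continuous_expR_paraboloid _ _ z nu k ((gamma + 1) * al)
    (K * c `^ (gamma + 1)) x0.
  have LE : L < K * c `^ (gamma + 1) *
      expR ((gamma + 1) * al * paraboloid z nu k x0) by rewrite -EE /L; lra.
  by apply: filterS (cvgr_gt _ Ec _ LE) => x; rewrite EE.
have opnear : \forall x \near x0, - pde_operator gamma p phi x <= - L.
  by apply: filterS Enear => x Lx; rewrite lerN2 (le_trans (ltW Lx)).
move=> /le_trans /(_ (lim_ereal_sup_eball_le opnear)).
rewrite lee_fin /L; lra.
Qed.

(** * Squared distances, compactness, and a ball of positivity touching the zero set *)

Section Separation.
Context {R : realType} {n : nat}.
Implicit Types (x y z : 'rV[R]_n) (Omega : set 'rV[R]_n) (u : 'rV[R]_n -> R).

Local Notation sqdist x y := (dot (x - y) (x - y)).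

Lemma sqdist_xx x : sqdist x x = 0.
Proof. by rewrite subrr -(scale0r (0 : 'rV[R]_n)) dotZl mul0r. Qed.

(** A triangle inequality without square roots: the two sides differ by the squared length of
    [v - w]. *)
Lemma sqdist_split x y z : sqdist x z <= 2 * (sqdist x y + sqdist y z).
Proof.
have -> : x - z = (x - y) + (y - z) by rewrite addrA subrK.
move: (x - y) (y - z) => v w.
by have := dot_ge0 (v - w); rewrite !dotE (dotC w v); lra.
Qed.

Lemma sqdist_lt_ball x y e : 0 < e -> sqdist y x < e ^+ 2 -> ball x e y.
Proof.
move=> e0 yx; apply: (@eball_sub_ball _ _ x e e) => //=.
by rewrite /eball/= -(@ltr_pXn2r _ 2) ?nnegrE ?sqrtr_ge0 ?ltW// sqr_enorm.
Qed.

Lemma near_sqdist_lt x z s : sqdist x z < s -> \forall y \near x, sqdist y z < s.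
Proof. by move=> xs; exact: cvgr_lt _ (@continuous_sqdist _ _ z x) _ xs. Qed.

Lemma closed_preimage_ge (f : 'rV[R]_n -> R) s :
  continuous f -> closed [set x | s <= f x].
Proof.
move=> fc; rewrite (_ : [set _ | _] = ~` [set x | f x < s]); last first.
  by apply/seteqP; split=> x /=; rewrite leNgt => /negP.
by apply: open_closedC; rewrite openE => x /= xs; exact: cvgr_lt _ (fc x) _ xs.
Qed.

Lemma closed_sqdist_le z s : closed [set x | sqdist x z <= s].
Proof.
rewrite (_ : [set _ | _] = [set x | - s <= - sqdist x z]).
  apply: closed_preimage_ge => x.
  exact: cvgN (@continuous_sqdist _ _ z x).
by apply/seteqP; split=> x /=; rewrite lerN2.
Qed.

Lemma bounded_closed_sub_compact Omega (A : set 'rV[R]_n) :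
  bounded_set Omega -> A `<=` Omega -> closed A -> compact A.
Proof.
move=> Ob AO Ac; apply: bounded_closed_compact => //.
case: Ob => M [Mr OM]; exists M; split=> // t /OM{}OM x /AO; exact: OM.
Qed.

Lemma near_within_gt Omega u x s : open Omega -> {within Omega, continuous u} ->
  Omega x -> s < u x -> \forall y \near x, Omega y /\ s < u y.
Proof.
move=> Oo; rewrite continuous_open_subspace// => uc Ox sx.
have Onear : \forall y \near x, Omega y by exact: open_nbhs_nbhs.
by near=> y; split; near: y => //; exact: cvgr_gt _ (uc x (mem_set Ox)) _ sx.
Unshelve. all: by end_near. Qed.

(** Connectedness gives a zero [z0] that is not interior to the zero set. Take a non-zero [y] of [u]
    close to [z0], and for [z] a zero nearest to [y]. *)
Lemma exists_interior_ball Omega u : domain Omega -> bounded_set Omega ->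
  {within Omega, continuous u} -> (forall x, Omega x -> 0 <= u x) ->
  (exists2 x, Omega x & u x = 0) -> (exists2 x, Omega x & 0 < u x) ->
  exists y z, [/\ Omega z, u z = 0, y != z &
    forall x, sqdist x y < sqdist z y -> Omega x /\ 0 < u x].
Proof.
move=> [_ Oo Oc] Ob uc u0 [xz Oxz uxz] [xp Oxp uxp].
pose Z := [set x | Omega x /\ u x = 0].
have pos x : Omega x -> ~ Z x -> 0 < u x.
  move=> Ox Zx; rewrite lt_neqAle u0// andbT eq_sym.
  by apply/eqP => ux; apply: Zx.
have [z0 [[Oz0 uz0] Zz0]] : exists z0, Z z0 /\ ~ nbhs z0 Z.
  apply: contrapT => /forallNP nZ.
  have Zo : open Z.
    rewrite openE => x Zx; apply: contrapT => nx; exact: (nZ x).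
  have Po : open [set x | Omega x /\ 0 < u x].
    rewrite openE => x [Ox ux]; exact: near_within_gt.
  have ZO : Z = Omega.
    apply: Oc; first by exists xz.
      by exists Z => //; apply/seteqP; split=> x [].
    exists (~` [set x | Omega x /\ 0 < u x]); first exact: open_closedC.
    apply/seteqP; split=> x [Ox].
      by move=> ux; split=> //= -[_]; rewrite ux ltxx.
    move=> /= nP; split=> //; apply: contrapT => ux.
    by apply: nP; split=> //; apply: pos => // -[].
  by move: Oxp; rewrite -ZO => -[_ ux]; move: uxp; rewrite ux ltxx.
have /nbhs_ballP[e /= e0 eO] : nbhs z0 Omega by exact: open_nbhs_nbhs.
have e40 : 0 < (e / 2) ^+ 2 by rewrite exprn_gt0// divr_gt0.
have [y yz0 Zy] : exists2 y, sqdist y z0 < (e / 2) ^+ 2 & ~ Z y.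
  apply: contrapT => nex; apply: Zz0.
  have : sqdist z0 z0 < (e / 2) ^+ 2 by rewrite sqdist_xx.
  move=> /near_sqdist_lt; apply: filterS => y yz; apply: contrapT => nZ.
  by apply: nex; exists y.
(* The radius e/2 is chosen for this: the squared distance to [z0] is at most four times that of
   [y], hence below e^2. *)
have BO x : sqdist x y <= sqdist y z0 -> Omega x.
  move=> xy; apply: eO; apply: sqdist_lt_ball => //.
  apply: le_lt_trans (sqdist_split x y z0) _.
  by move: yz0; rewrite expr_div_n; lra.
have Oy : Omega y by apply: BO; rewrite sqdist_xx dot_ge0.
pose K := [set x | sqdist x y <= sqdist y z0] `&` Z.
have KO : K `<=` Omega by move=> x [_ []].
(* Continuity of [u] is known only within [Omega], so the zeros in the closed ball are obtained by
   removing the open set where [u] is positive. *)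
have Kc : closed K.
  rewrite (_ : K = [set x | sqdist x y <= sqdist y z0] `\`
                   [set x | Omega x /\ 0 < u x]).
    rewrite setDE; apply: closedI; first exact: closed_sqdist_le.
    apply: open_closedC; rewrite openE => x [Ox ux]; exact: near_within_gt.
  apply/seteqP; split=> x /= [xB].
    by move=> [Ox ux]; split=> // -[_]; rewrite ux ltxx.
  move=> nP; have Ox := BO x xB; split=> //; apply: contrapT => nZ.
  by apply: nP; split=> //; exact: pos.
have K0 : K !=set0.
  exists z0; split=> //=.
  by rewrite -(opprB y z0) dotNl dotNr opprK.
have [z] := compact_EVT_min K0 (bounded_closed_sub_compact Ob KO Kc)
  (continuous_subspaceT (@continuous_sqdist _ _ y)).
rewrite inE => -[zB [Oz uz]] zmin; exists y, z; split=> //.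
  by apply/eqP => yz; apply: Zy; rewrite yz.
move=> x xy; have xB := ltW (lt_le_trans xy zB); have Ox := BO x xB.
split=> //; apply: pos => // Zx.
by have := zmin x (mem_set (conj xB Zx)); rewrite leNgt xy.
Qed.

End Separation.

(** * The paraboloid compared with the ball near the touching point *)

Section TouchingPoint.
Context {R : realType} {n : nat}.
Variables (y z : 'rV[R]_n).
Hypothesis yz : y != z.

Let r := enorm (y - z).
Let nu := r^-1 *: (y - z).

Lemma enorm_sub_gt0 : 0 < r.
Proof. by rewrite /r enormE sqrtr_gt0 dot_gt0// subr_eq0. Qed.

Lemma dot_unit_normal : dot nu nu = 1.
Proof.
have r0 := enorm_sub_gt0.
rewrite /nu dotZl dotZr -sqr_enorm -/r mulrA -expr2 -exprMn.
by rewrite mulVf ?expr1n// gt_eqF.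
Qed.

(** By Cauchy-Schwarz the quadratic term only lowers the value, and the linear term is at most the
    distance to [z]. *)
Lemma paraboloid_le (k : R) x : 0 <= k -> paraboloid z nu k x <= enorm (x - z).
Proof.
move=> k0; have := dot_sqr_le (x - z) dot_unit_normal.
rewrite /paraboloid; set t := dot nu _; rewrite -sqr_enorm => tx.
have tle : t <= enorm (x - z).
  rewrite (le_trans (ler_norm t))//.
  by rewrite -(@ler_pXn2r _ 2) ?nnegrE ?sqrtr_ge0// real_normK ?num_real.
by have : 0 <= k * (enorm (x - z) ^+ 2 - t ^+ 2);
  [rewrite mulr_ge0// subr_ge0|lra].
Qed.

(* With w = x - z and t = nu.w, the condition psi x >= 0 reads
   |w|^2 <= r t + t^2, and x lies in the ball of centre y when |w|^2 < 2 r t. *)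
Lemma paraboloid_ge0_sub_ball x : x != z -> enorm (x - z) < r ->
  0 <= paraboloid z nu r^-1 x -> dot (x - y) (x - y) < dot (z - y) (z - y).
Proof.
move=> xz xr; have r0 := enorm_sub_gt0.
have w0 : 0 < dot (x - z) (x - z) by rewrite dot_gt0// subr_eq0.
have tx := dot_sqr_le (x - z) dot_unit_normal.
have yE : y - z = r *: nu by rewrite scalerA divff ?scale1r// gt_eqF.
have xyE : x - y = (x - z) - r *: nu by rewrite -yE opprB addrA subrK.
have shift (v w : 'rV[R]_n) : dot v v = 1 ->
    dot (w - r *: v) (w - r *: v) = dot w w - 2 * (r * dot v w) + r ^+ 2.
  by move=> v1; rewrite !dotE v1 (dotC w v); ring.
have -> : dot (z - y) (z - y) = r ^+ 2.
  by rewrite -sqr_enorm -opprB -scaleN1r enormZ normrN1 mul1r.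
rewrite xyE shift ?dot_unit_normal// /paraboloid; move: tx w0 xr; rewrite -sqr_enorm.
set t := dot nu (x - z); set N := enorm (x - z) => tx w0 xr psi0.
have N0 : 0 <= N by exact: sqrtr_ge0.
have psi1 : N ^+ 2 - t ^+ 2 <= r * t.
  have := ler_wpM2l (ltW r0) psi0.
  by rewrite mulr0 mulrBr mulrA divff ?gt_eqF// mul1r; lra.
have tr : t ^+ 2 < r ^+ 2.
  by apply: le_lt_trans tx _; rewrite ltr_pXn2r ?nnegrE// ltW.
have tr1 : `|t| < r.
  by rewrite -(@ltr_pXn2r _ 2) ?nnegrE ?(ltW r0)// real_normK ?num_real.
move: tr1; rewrite ltr_norml => /andP[tr1 tr2].
(* Here 0 < N^2 <= t (r + t), and r + t > 0. *)
have t0 : 0 < t by nra.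
nra.
Qed.

End TouchingPoint.

(** * Comparison of [u] with the barrier around a boundary zero *)

Theorem theorem1p9 (R : realType) (n : nat) (Omega : set 'rV[R]_n)
    (p gamma lambda0 Lambda0 : R) (a u : 'rV[R]_n -> R)
    (n_gt0 : (0 < n)%N)
    (Omega_domain : domain Omega)
    (Omega_bounded : bounded_set Omega)
    (p_gt1 : 1 < p)
    (gamma_gtN1 : -1 < gamma)
    (a_cont : {within Omega, continuous a})
    (lambda0_gt0 : 0 < lambda0)
    (a_bounds : forall x, Omega x -> lambda0 <= a x <= Lambda0)
    (u_ge0 : forall x, Omega x -> 0 <= u x)
    (u_bounded : [bounded u x | x in Omega])
    (u_sol : viscosity_solution gamma p
       (fun x t => a x * Num.max t 0 `^ (gamma + 1)) Omega u) :
  (forall x, Omega x -> 0 < u x) \/ (forall x, Omega x -> u x = 0).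
Proof.
case: u_sol => uc _ usup.
have [zero|nozero] := pselect (exists2 x, Omega x & u x = 0); last first.
  left=> x Ox; rewrite lt_neqAle u_ge0// andbT eq_sym.
  by apply/eqP => ux; apply: nozero; exists x.
right; apply: contrapT => nz.
have [x1 Ox1 ux1] : exists2 x, Omega x & 0 < u x.
  apply: contrapT => npos; apply: nz => x Ox; apply/eqP; rewrite eq_le u_ge0//.
  by rewrite andbT leNgt; apply/negP => ux; apply: npos; exists x.
have [y [z [Oz uz yz ball_pos]]] := exists_interior_ball Omega_domain
  Omega_bounded uc u_ge0 zero (ex_intro2 _ _ x1 Ox1 ux1).
have [_ Oo _] := Omega_domain.
set r := enorm (y - z); set nu := r^-1 *: (y - z).
have r0 : 0 < r := enorm_sub_gt0 yz.
have nu1 : dot nu nu = 1 := dot_unit_normal yz.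
have rV0 : 0 <= r^-1 by rewrite invr_ge0 ltW.
have L0 : 0 < Lambda0.
  have /andP[az zL] := a_bounds z Oz.
  exact: lt_le_trans lambda0_gt0 (le_trans az zL).
have /nbhs_ballP[e /= e0 eO] : nbhs z Omega by exact: open_nbhs_nbhs.
(* Below [e], the closed ball [K] stays in [Omega]; below [r], the part of it with [psi >= 0] other
   than [z] lies in the ball where [u > 0]. *)
pose rho := Num.min e r / 2.
have rho0 : 0 < rho by rewrite divr_gt0// lt_min e0.
have rhor : rho < r.
  have : Num.min e r <= r by rewrite ge_min lexx orbT.
  by rewrite /rho; lra.
have rhoe : rho < e.
  have : Num.min e r <= e by rewrite ge_min lexx.
  by rewrite /rho; lra.
pose K := [set x | dot (x - z) (x - z) <= rho ^+ 2].
have KO : K `<=` Omega.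
  move=> x Kx; apply: eO; apply: sqdist_lt_ball => //.
  by rewrite (le_lt_trans Kx)// ltr_pXn2r// nnegrE ltW.
have Kc : compact K.
  exact: bounded_closed_sub_compact KO (@closed_sqdist_le _ _ _ _).
have Krho x : K x -> enorm (x - z) <= rho.
  rewrite /K/= -sqr_enorm ler_pXn2r ?nnegrE ?sqrtr_ge0//; exact: ltW.
pose C := 2 * r^-1 * (n%:R + `|p - 2|).
(* With this choice (p - 1) al - C equals (p - 1) + Lambda0, strictly above [Lambda0]. *)
pose al := 1 + (Lambda0 + C) / (p - 1).
have C0 : 0 <= C by rewrite !mulr_ge0// addr_ge0.
have al1 : 1 <= al by rewrite lerDl divr_ge0; lra.
have alK : Lambda0 < (p - 1) * al - C.
  rewrite /al mulrDr mulr1 mulrCA divff; last by rewrite gt_eqF; lra.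
  lra.
pose psi := paraboloid z nu r^-1.
have psi_pos x : K x -> x != z -> 0 <= psi x -> 0 < u x.
  move=> Kx xz psi0; apply: (ball_pos x _).2.
  by apply: paraboloid_ge0_sub_ball => //; exact: le_lt_trans (Krho _ Kx) rhor.
(* The part of the sphere of radius [rho] on which [psi >= 0]. It is compact and avoids [z], so [u]
   has a positive lower bound on it. *)
pose S := K `&` [set x | rho ^+ 2 <= dot (x - z) (x - z) /\ 0 <= psi x].
have [mu mu0 muS] : exists2 mu, 0 < mu & forall x, S x -> mu <= u x.
  have [S0|] := pselect (S !=set0); last first.
    by move=> S0; exists 1 => // x Sx; case: S0; exists x.
  have Sc : compact S.
    apply: bounded_closed_sub_compact Omega_bounded _ _ => [x [/KO]//|].
    apply: closedI; first exact: closed_sqdist_le.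
    apply: closedI.
      exact: closed_preimage_ge (@continuous_sqdist _ _ z).
    exact: closed_preimage_ge (@continuous_paraboloid _ _ z nu r^-1).
  have SO : S `<=` Omega by move=> x [/KO].
  have [x] := compact_EVT_min S0 Sc (continuous_subspaceW SO uc).
  rewrite inE => -[Kx [xrho psi0]] xmin; exists (u x).
    apply: psi_pos => //; apply/eqP => xz; move: xrho.
    by rewrite xz sqdist_xx leNgt exprn_gt0.
  by move=> x' Sx'; apply: xmin; rewrite inE.
(* On the sphere [psi <= rho], so c exp(al psi) is at most [mu] there. *)
pose c := mu / expR (al * rho).
have c0 : 0 < c by rewrite divr_gt0// expR_gt0.
pose phi := barrier z nu r^-1 al c (- c).
have phiz : phi z = 0.
  rewrite /phi /barrier /paraboloid sqdist_xx.
  rewrite subrr -(scale0r nu) dotZr mul0r expr0n/= subr0 mulr0 subr0 mulr0 expR0.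
  by rewrite mulr1 subrr.
have Kz : K z by rewrite /K/= sqdist_xx exprn_ge0// ltW.
have vc : {within K, continuous (fun x => u x - phi x)}.
  apply: continuous_funB; first exact: continuous_subspaceW KO uc.
  exact/continuous_subspaceT/continuous_barrier.
have [x0] := compact_EVT_min (ex_intro _ z Kz) Kc vc.
rewrite inE => Kx0 x0min.
have mle : u x0 - phi x0 <= 0.
  by have := x0min z (mem_set Kz); rewrite uz phiz subrr.
(* On the sphere [u > phi]: where [psi >= 0], phi <= mu - c < mu <= u; where [psi < 0], phi < 0 <=
   u. A non-positive minimum is therefore attained inside. *)
have x0rho : dot (x0 - z) (x0 - z) < rho ^+ 2.
  rewrite ltNge; apply/negP => x0rho; move: mle; rewrite leNgt => /negP; apply.
  rewrite subr_gt0 /phi /barrier.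
  have [psi0|psi0] := lerP 0 (psi x0).
    have psirho : psi x0 <= rho.
      by apply: le_trans (Krho _ Kx0); exact: paraboloid_le.
    have : c * expR (al * psi x0) <= mu.
      rewrite /c -mulrA ler_piMr ?(ltW mu0)// mulrC ler_pdivrMr ?expR_gt0//.
      by rewrite mul1r ler_expR ler_wpM2l//; lra.
    have := muS x0 (conj Kx0 (conj x0rho psi0)).
    rewrite /psi; lra.
  have : c * expR (al * psi x0) < c.
    by rewrite gtr_pMr// -expR0 ltr_expR pmulr_rlt0//; lra.
  by have := u_ge0 _ (KO _ Kx0); rewrite /psi; lra.
(* The minimum of [u - phi] is added to the constant [- c] already in [phi], so that the translate
   meets [u] at [x0]. *)
pose m := u x0 - phi x0 - c.
have m0 : m <= 0 by rewrite /m; lra.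
apply: (@barrier_not_touching_from_below _ _ Omega p gamma Lambda0 a u z nu r^-1
  al c m x0) => //; rewrite ?(ltW L0)//; last 2 first.
- exact: KO.
- have shift x : barrier z nu r^-1 al c m x = phi x + (u x0 - phi x0).
    by rewrite /m /phi /barrier; ring.
  split; first by rewrite shift addrC subrK.
  have : \forall x \near x0, K x.
    by apply: filterS (near_sqdist_lt x0rho) => x /ltW.
  apply: filterS => x Kx; rewrite !shift.
  by have := x0min x (mem_set Kx); lra.
- move=> x /a_bounds /andP[la aL]; rewrite aL andbT.
  exact: le_trans (ltW lambda0_gt0) la.
Qed.
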